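(* Let $\kappa$ be an infinite cardinal, and let $\mathcal{L}\subsetneq\mathrm{Lin}_\kappa$ be nonempty and downward $\preceq$-closed and such that $\trianglelefteq^{\mathcal{L}}_\kappa$ is transitive. Then the quasi-order $\trianglelefteq^{\mathcal{L}}_\kappa$ has no maximal element, and every dominating family with respect to $\trianglelefteq^{\mathcal{L}}_\kappa$ has size $2^\kappa$. Hence $\mathfrak{d}(\trianglelefteq^{\mathcal{L}}_\kappa)=2^\kappa$.
   Context: Linear orders are reflexive and nonempty; $L\preceq L'$ means there is an embedding $f:L\to L'$, i.e. $x\le_L y\iff f(x)\le_{L'}f(y)$. For a cardinal $\kappa$, $\mathrm{LO}_\kappa$ is the set of (codes for) linear orders with domain $\kappa$, and $\mathrm{Lin}_\kappa=\bigcup_{0<\lambda\le\kappa}\mathrm{LO}_\lambda$ ($\lambda$ ranging over cardinals), i.e. the nonempty linear orders of size at most $\kappa$. $\mathcal{L}\subseteq\mathrm{Lin}_\kappa$ is downward $\preceq$-closed if $K\in\mathrm{Lin}_\kappa$, $K\preceq L\in\mathcal{L}$ imply $K\in\mathcal{L}$; membership is meant up to isomorphism. A subset $I$ of $L$ is convex if $x\le_L y\le_L z$ and $x,z\in I$ imply $y\in I$. A $K$-convex partition of $L$ is a partition $(L_k)_{k\in K}$ of $L$ (into nonempty sets) such that $k<_K k'\iff$ every element of $L_k$ is $<_L$ every element of $L_{k'}$. $L\trianglelefteq^{\mathcal{L}}L'$ iff there are $K\in\mathcal{L}$, a $K$-convex partition $(L_k)_{k\in K}$ of $L$, and an embedding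 $f$ of $L$ into $L'$ such that each $f(L_k)$ is a convex subset of $L'$. $\trianglelefteq^{\mathcal{L}}_\kappa$ is the restriction of $\trianglelefteq^{\mathcal{L}}$ to $\mathrm{LO}_\kappa$. For a quasi-order $\precsim$ on $X$: $x$ is maximal if there is no $y\in X$ with $x\precsim y$ and $y\not\precsim x$; $\mathcal{F}\subseteq X$ is a dominating family if for every $x\in X$ there is $y\in\mathcal{F}$ with $x\precsim y$; $\mathfrak{d}(\precsim)$ is the least size of a dominating family. *)

(* Defs.v *)
From mathcomp Require Import all_boot.
From mathcomp Require Import boolp classical_sets functions cardinality.

Set Implicit Arguments.
Unset Strict Implicit.
Unset Printing Implicit Defensive.

Local Open Scope classical_set_scope.
Local Open Scope card_scope.

Record linear_order (T : Type) := LinearOrder {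
  lo_le :> rel T;
  lo_refl : reflexive lo_le;
  lo_antisym : antisymmetric lo_le;
  lo_trans : transitive lo_le;
  lo_total : total lo_le }.

Definition lo_lt (T : Type) (L : linear_order T) (x y : T) : Prop :=
  L x y /\ x <> y.

(* [lin K] plays the role of Lin_kappa when K has cardinality kappa: every
   nonempty linear order of size at most kappa is isomorphic to one whose
   domain is a nonempty subset of K. *)
Record lin (K : Type) := Lin {
  lin_dom : set K;
  lin_dom_neq0 : lin_dom !=set0;
  lin_ord :> linear_order lin_dom }.

Definition lo_embedding (S T : Type) (L : linear_order S) (M : linear_order T)
    (f : S -> T) : Prop :=
  {mono f : x y / L x y >-> M x y}.

Definition lo_embeds (S T : Type) (L : linear_order S) (M : linear_order T) :
    Prop :=
  exists f : S -> T, lo_embedding L M f.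

(* This includes closure under isomorphism, so LL is in effect a class of
   isomorphism types. *)
Definition downward_closed (K : Type) (LL : set (lin K)) : Prop :=
  forall M N : lin K, lo_embeds M N -> LL N -> LL M.

Definition lo_convex (T : Type) (L : linear_order T) (I : set T) : Prop :=
  forall x y z, L x y -> L y z -> I x -> I z -> I y.

Definition convex_partition (I T : Type) (J : linear_order I)
    (L : linear_order T) (P : I -> set T) : Prop :=
  partition setT P setT /\
  forall k k' : I,
    lo_lt J k k' <-> (forall x y, P k x -> P k' y -> lo_lt L x y).

Definition piecewise_convex_le (K : Type) (LL : set (lin K)) (S T : Type)
    (L : linear_order S) (M : linear_order T) : Prop :=
  exists J : lin K, LL J /\
  exists P : lin_dom J -> set S, convex_partition J L P /\
  exists f : S -> T, lo_embedding L M f /\ forall k, lo_convex M (f @` P k).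

(* The restriction of [piecewise_convex_le] to LO_kappa, the linear orders
   with domain K. *)
Definition piecewise_convex_le_on (K : Type) (LL : set (lin K)) :
    linear_order K -> linear_order K -> Prop :=
  fun L M => piecewise_convex_le LL L M.

Definition maximal_elt (X : Type) (R : X -> X -> Prop) (x : X) : Prop :=
  ~ exists y, R x y /\ ~ R y x.

Definition dominating (X : Type) (R : X -> X -> Prop) (F : set X) : Prop :=
  forall x, exists2 y, F y & R x y.

(* The least size of a dominating family for R is the cardinality of C. *)
Definition dominating_number_is (X U : Type) (R : X -> X -> Prop) (C : set U) :
    Prop :=
  (exists2 F : set X, dominating R F & F #= C) /\
  (forall F : set X, dominating R F -> C #<= F).

(* Main.v *)
Require Import Defs.
From mathcomp Require Import all_boot.
From mathcomp Require Import boolp classical_sets functions cardinality.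
From mathcomp Require Import wochoice zify.
From Stdlib Require Import RelationClasses.

(** The argument rests on the orders A_X ([coded_order]), one for each subset X
    of an infinite K.  Well-order K, and let A_X be the sum, along this
    well-order, of one countable block for each k : K: the block is omega if k
    is in X, and a least point followed by a copy of the integers otherwise.  In
    A_X the first points of the blocks are exactly the points without an
    immediate predecessor, and the first point of the k-th block has an
    immediate successor exactly when k is in X.  By induction along the
    well-order, two embeddings of A_X and A_Y with convex range into the same
    order that agree on the least point agree on all first points of blocks, so
    that X = Y ([coded_order_determined]).  Hence a linear order on K admits at
    most card(K) of the orders A_X as convex suborders.

    Passing from convex to piecewise convex embeddings uses properness of the
    class: choose a linear order N, of size at most card(K), outside it.  If a
    convex partition of N-many consecutive copies of A were to split every copy,
    then sending each copy to a piece that it meets, but not the first such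
    piece, would embed N in the index of the partition; so if the index lies in
    the downward closed class, some copy lies in a single piece
    ([piecewise_convex_copy]).  Consequently, every L extends to an order M,
    isomorphic to L followed by N-many copies of A_X, such that anything
    piecewise above M has A_X as a convex suborder ([coded_extension]); M has
    size card(K) because card(K) is its own square ([infinite_square]).

    No L is maximal: take X such that A_X is not a convex suborder of L.
    If F is dominating, sending X to an element of F above the extension
    associated with X, together with the image of the least point of A_X,
    injects the power set of K into F * K; since the power set of K is its own
    K-th power, a diagonal argument in the style of Koenig turns this into an
    injection into F ([power_injection_factor]). *)

Set Implicit Arguments.
Unset Strict Implicit.
Unset Printing Implicit Defensive.

Local Open Scope classical_set_scope.
Local Open Scope card_scope.

(** * The square of an infinite set *)

Lemma injective_card_le S T (f : S -> T) (B : set T) :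
  injective f -> (forall x, B (f x)) -> [set: S] #<= B.
Proof.
move=> fI Bf; apply/card_leP; apply/injfunPex.
exists (fun x : [set: S] => SigSub (mem_set (Bf (val x)))) => //.
by move=> x y _ _ [] /fI /val_inj.
Qed.

Section Comparability.
Variables A B : Type.

(** Graphs of injections from a part of [A] to [B].  A maximal one is defined
    everywhere or onto. *)
Let partial_inj (G : set (A * B)) :=
  (forall a b b', G (a, b) -> G (a, b') -> b = b') /\
  (forall a a' b, G (a, b) -> G (a', b) -> a = a').

Lemma injective_comparable :
  (exists f : A -> B, injective f) \/ (exists f : B -> A, injective f).
Proof.
have [F FP Ftot|G [[Gf Gi] Gmax]] := @Zorn_bigcup (A * B) partial_inj.
  split.
    move=> a b b' [X FX Xb] [Y FY Yb].
    have [XY|YX] := Ftot _ _ FX FY.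
      by apply: ((FP _ FY).1 a) => //; exact: XY.
    by apply: ((FP _ FX).1 a) => //; exact: YX.
  move=> a b b' [X FX Xb] [Y FY Yb].
  have [XY|YX] := Ftot _ _ FX FY.
    by apply: ((FP _ FY).2 _ _ b') => //; exact: XY.
  by apply: ((FP _ FX).2 _ _ b') => //; exact: YX.
have [/choice[f fG]|/existsNP[a aG]] := pselect (forall a, exists b, G (a, b)).
  by left; exists f => a a' e; apply: (Gi _ _ (f a)); rewrite // e.
have [/choice[f fG]|/existsNP[b bG]] := pselect (forall b, exists a, G (a, b)).
  by right; exists f => b b' e; apply: (Gf (f b)); rewrite // e.
exfalso; apply: (Gmax (G `|` [set (a, b)])).
  split; first by move=> p Gp; left.
  by move=> /(_ (a, b) (or_intror erefl)) Gab; apply: aG; exists b.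
split.
  move=> x y y' [Gy|[-> ->]] [Gy'|] //.
  - exact: (Gf x).
  - by move=> [xa]; exfalso; apply: aG; exists y; rewrite -xa.
  - by exfalso; apply: aG; exists y'.
  - by case.
move=> x x' y [Gx|[-> ->]] [Gx'|] //.
- exact: (Gi _ _ y).
- by move=> [_ yb]; exfalso; apply: bG; exists x; rewrite -yb.
- by exfalso; apply: bG; exists x'.
- by case.
Qed.
End Comparability.

Section Square.
Variable K : Type.
Hypothesis K_infinite : infinite_set [set: K].

(** The restriction of [f] to [D * D] is an injection of [D * D] into [D]. *)
Definition square_coding (D : set K) (f : K -> K -> K) :=
  (forall x y, D x -> D y -> D (f x y)) /\
  (forall x y x' y', D x -> D y -> D x' -> D y' ->
     f x y = f x' y' -> x = x' /\ y = y').

(** If [D], which contains infinitely many distinct points [s n], codes its own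
    pairs and [e] injects it into its complement, then the union of [D] and its
    image codes its own pairs too, by an extension of the coding of [D].  The
    new pairs split into three copies of [D * D] according to the side of each
    component; they are coded inside the image, with the sides recorded by the
    points [s 1], [s 2] and [s 3]. *)
Lemma square_coding_extend (D : set K) f (s : nat -> K) (e : K -> K) :
  square_coding D f -> injective s -> (forall n, D (s n)) ->
  (forall x, D x -> ~ D (e x)) ->
  (forall x y, D x -> D y -> e x = e y -> x = y) ->
  exists h, square_coding (D `|` e @` D) h /\
    (forall x y, D x -> D y -> h x y = f x y).
Proof.
move=> [fD fI] sI sD eD eI.
(* r x gives the side of x, and the point of D that x is or comes from. *)
have /choice[r rP] : forall x, exists q : bool * K, (D `|` e @` D) x ->
    D q.2 /\ x = if q.1 then e q.2 else q.2.
  move=> x.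
  have [[Dx|[y Dy <-]]|nx] := pselect ((D `|` e @` D) x).
  - by exists (false, x).
  - by exists (true, y).
  - by exists (false, x).
have rI x x' : (D `|` e @` D) x -> (D `|` e @` D) x' -> r x = r x' -> x = x'.
  by move=> /rP[_ {2}->] /rP[_ {2}->] ->.
have rD x : D x -> r x = (false, x).
  move=> Dx; have /rP[] : (D `|` e @` D) x by left.
  case: (r x) => -[] u /= Du xE; last by rewrite xE.
  by exfalso; apply: (eD _ Du); rewrite -xE.
pose c (a b : bool) := s (a + b.*2)%N.
have cI a b a' b' : c a b = c a' b' -> a = a' /\ b = b'.
  by move=> /sI; case: a; case: b; case: a'; case: b'.
exists (fun x y => let p := r x in let q := r y in
  if p.1 || q.1 then e (f (c p.1 q.1) (f p.2 q.2)) else f p.2 q.2).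
split; last by move=> x y Dx Dy; rewrite (rD _ Dx) (rD _ Dy).
have ccD a b : D (c a b) by exact: sD.
split=> [x y /rP[ux _] /rP[uy _] /=|].
  case: ifP => _; [right | by left; apply: fD].
  by exists (f (c (r x).1 (r y).1) (f (r x).2 (r y).2)) => //; auto.
move=> x y x' y' Dx Dy Dx' Dy' /=.
suff H : r x = r x' /\ r y = r y' -> x = x' /\ y = y'.
  have [ux _] := rP _ Dx; have [uy _] := rP _ Dy.
  have [ux' _] := rP _ Dx'; have [uy' _] := rP _ Dy'.
  move=> E; apply: H; move: ux uy ux' uy' E.
  case: (r x) => a u; case: (r y) => b v; case: (r x') => a' u'.
  case: (r y') => b' v' /= Du Dv Du' Dv'.
  case: ifP => [ab|/norP[/negPf-> /negPf->]];
    case: ifP => [ab'|/norP[/negPf-> /negPf->]] E.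
  - have [] := fI _ _ _ _ _ _ _ _ (eI _ _ _ _ E); auto.
    move=> /cI[-> ->] /fI[]; auto.
    by move=> -> ->.
  - by exfalso; apply: (eD (f (c a b) (f u v))); rewrite ?E; auto.
  - by exfalso; apply: (eD (f (c a' b') (f u' v'))); rewrite -?E; auto.
  - by have [] := fI _ _ _ _ _ _ _ _ E; auto; move=> -> ->.
by move=> [rx ry]; split; exact: rI.
Qed.

(** The set of points paired with themselves: the set [D] if [G] is the graph of
    a map on [D * D]. *)
Let field (G : set (K * K * K)) : set K := [set x | exists z, G (x, x, z)].

(** Graphs of injections of [D * D] into [D], with [D] empty or infinite.  The
    empty graph is included for the sake of the empty chain in the application
    of the lemma of Zorn. *)
Let square_graph (G : set (K * K * K)) :=
  [/\ forall x y z, G (x, y, z) -> [/\ field G x, field G y & field G z],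
      forall x y, field G x -> field G y -> exists z, G (x, y, z),
      forall x y z z', G (x, y, z) -> G (x, y, z') -> z = z',
      forall x y x' y' z, G (x, y, z) -> G (x', y', z) -> x = x' /\ y = y' &
      G !=set0 -> infinite_set (field G)].

Let field_sub G H : G `<=` H -> field G `<=` field H.
Proof. by move=> GH x [z /GH Hz]; exists z. Qed.

Let square_graph_bigcup (F : set (set (K * K * K))) :
  F `<=` square_graph -> total_on F subset ->
  square_graph (\bigcup_(X in F) X).
Proof.
move=> FP Ftot.
have two X Y : F X -> F Y -> exists Z, [/\ F Z, X `<=` Z & Y `<=` Z].
  move=> FX FY.
  by have [XY|YX] := Ftot _ _ FX FY; [exists Y|exists X]; split=> // ?.
have sub X : F X -> X `<=` \bigcup_(X in F) X by move=> FX p Xp; exists X.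
split.
- move=> x y z [X FX Xp]; have [H _ _ _ _] := FP _ FX.
  have [Dx Dy Dz] := H _ _ _ Xp.
  by split; apply: (field_sub (sub _ FX)).
- move=> x y [u [X FX Xu]] [v [Y FY Yv]]; have [Z [FZ XZ YZ]] := two _ _ FX FY.
  have [_ H _ _ _] := FP _ FZ.
  have [|| z Zz] := H x y; first by exists u; exact: XZ.
    by exists v; exact: YZ.
  by exists z, Z.
- move=> x y z z' [X FX Xz] [Y FY Yz]; have [Z [FZ XZ YZ]] := two _ _ FX FY.
  by have [_ _ H _ _] := FP _ FZ; apply: (H x y); [exact: XZ|exact: YZ].
- move=> x y x' y' z [X FX Xz] [Y FY Yz].
  have [Z [FZ XZ YZ]] := two _ _ FX FY.
  by have [_ _ _ H _] := FP _ FZ; apply: (H _ _ _ _ z); [exact: XZ|exact: YZ].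
- move=> [p [X FX Xp]]; have [_ _ _ _ H] := FP _ FX.
  apply: sub_infinite_set (H _); last by exists p.
  exact: field_sub (sub _ FX).
Qed.

Let graph (D : set K) (f : K -> K -> K) : set (K * K * K) :=
  [set p | [/\ D p.1.1, D p.1.2 & p.2 = f p.1.1 p.1.2]].

Let field_graph D f : field (graph D f) = D.
Proof.
apply/seteqP; split=> x; first by move=> [z []].
by move=> Dx; exists (f x x).
Qed.

Let square_graph_of D f : infinite_set D -> square_coding D f ->
  square_graph (graph D f).
Proof.
move=> Dinf [fD fI]; split; rewrite ?field_graph //.
- by move=> x y z [/= Dx Dy ->]; split => //; exact: fD.
- by move=> x y Dx Dy; exists (f x y).
- by move=> x y z z' [/= _ _ ->] [/= _ _ ->].
- by move=> x y x' y' z [/= Dx Dy ->] [/= Dx' Dy' /fI]; auto.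
Qed.

Lemma infinite_set_nat_injection (D : set K) : infinite_set D ->
  exists s : nat -> K, injective s /\ forall n, D (s n).
Proof.
move=> /infiniteP/card_leP[s]; exists (fun n => val (s (SigSub (mem_setT n)))).
split=> [m n /val_inj|n]; last exact: set_valP.
by move=> /inj -/(_ (mem_setT _) (mem_setT _)) [].
Qed.

(** Every infinite set is equipotent to its square.  Take a maximal injection of
    [D * D] into [D] with [D] infinite.  By maximality [D] does not inject into
    its complement, hence the complement injects into [D], and [K] is at most
    two copies of [D], which fit in [D * D] and so in [D]. *)
Theorem infinite_square : exists c : K * K -> K, injective c.
Proof.
have [G [[Gd Gt Gf Gi Ginf] Gmax]] := Zorn_bigcup square_graph_bigcup.
have [s0 [s0I _]] := infinite_set_nat_injection K_infinite.
have Gn : G !=set0.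
  (* A countable subset gives a nonempty member of the family. *)
  apply: contrapT => G0; have {}G0 : G = set0.
    by apply/seteqP; split=> // p Gp; apply: G0; exists p.
  have [c cI] : exists c : nat * nat -> nat, injective c.
    by exists pickle; exact: pcan_inj pickleK.
  have /choice[t tP] : forall x, exists n, forall m, x = s0 m -> n = m.
    move=> x; have [[n ->]|h] := pselect (exists n, x = s0 n).
      by exists n => m /s0I.
    by exists 0 => m xE; case: h; exists m.
  have tK n : t (s0 n) = n by exact: tP.
  pose D := range s0; pose f x y := s0 (c (t x, t y)).
  have Dinf : infinite_set D.
    by apply/infiniteP; apply: (injective_card_le s0I) => n; exists n.
  have cod : square_coding D f.
    split=> [x y _ _|x y x' y' [m _ <-] [n _ <-] [m' _ <-] [n' _ <-]].
      by exists (c (t x, t y)).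
    by rewrite /f !tK => /s0I/cI[-> ->].
  apply: (Gmax _ _ (square_graph_of Dinf cod)); rewrite G0.
  split=> // /(_ (s0 0, s0 0, f (s0 0) (s0 0))) []; split => //=; by exists 0.
set D := field G in Gd Gt Ginf.
have Dinf := Ginf Gn.
have [f fP] : exists f : K -> K -> K, forall x y, D x -> D y -> G (x, y, f x y).
  have [f fP] : exists f : K * K -> K, forall p, D p.1 -> D p.2 -> G (p, f p).
    suff /choice[f fP] : forall p : K * K, exists z,
        D p.1 -> D p.2 -> G (p, z) by exists f.
    move=> [x y] /=; have [[Dx Dy]|h] := pselect (D x /\ D y).
      by have [z] := Gt _ _ Dx Dy; exists z.
    by exists x => Dx Dy; case: h.
  by exists (fun x y => f (x, y)) => x y; exact: (fP (x, y)).
have fcod : square_coding D f.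
  split=> [x y Dx Dy|x y x' y' Dx Dy Dx' Dy' E].
    by have [] := Gd _ _ _ (fP _ _ Dx Dy).
  by apply: (Gi _ _ _ _ (f x y)); [exact: fP|rewrite E; exact: fP].
have [s [sI sD]] := infinite_set_nat_injection Dinf.
have [[e eI]|[g gI]] := injective_comparable D (~` D).
  exfalso.
  have /choice[e' e'P] : forall x, exists y,
      forall Dx : x \in D, y = val (e (SigSub Dx)).
    move=> x; have [Dx|nDx] := pselect (x \in D); last by exists x.
    exists (val (e (SigSub Dx))) => Dx'; congr (val (e _)); exact: val_inj.
  have eD u : ~ D (val (e u)) by case: (e u) => y /= /set_mem.
  have [||h [hcod hf]] := square_coding_extend (e := e') fcod sI sD.
  - by move=> x Dx; rewrite (e'P _ (mem_set Dx)); exact: eD.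
  - move=> x y Dx Dy; rewrite (e'P _ (mem_set Dx)) (e'P _ (mem_set Dy)).
    by move=> /val_inj/eI[].
  have inf' : infinite_set (D `|` e' @` D).
    by apply: sub_infinite_set Dinf => x; left.
  apply: (Gmax _ _ (square_graph_of inf' hcod)); split.
    move=> [[x y] z] Gz; have [Dx Dy _] := Gd _ _ _ Gz.
    split; [by left|by left|rewrite hf //=].
    by apply: (Gf x y) => //; exact: fP.
  have D0 := sD 0.
  move=> sub; have D1 : D (e' (s 0)).
    by apply: (field_sub sub); rewrite field_graph; right; exists (s 0).
  by move: D1; rewrite (e'P _ (mem_set D0)); exact: eD.
have [fD fI] := fcod.
have [i [iD iI]] : exists i : K -> K, (forall x, D (i x)) /\ injective i.
  have /choice[i iP] : forall x, exists y,
      (D x /\ y = f (s 0) x) \/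
      (exists nDx : x \in ~` D, y = f (s 1%N) (val (g (SigSub nDx)))).
    move=> x; have [Dx|nDx] := pselect (D x); first by exists (f (s 0) x); left.
    exists (f (s 1%N) (val (g (SigSub (mem_set (nDx : (~` D) x)))))); right.
    by exists (mem_set (nDx : (~` D) x)).
  have gD u : D (val (g u)) by case: (g u) => y /= /set_mem.
  exists i; split=> [x|x y].
    by have [[Dx ->]|[u ->]] := iP x; apply: fD.
  have [[Dx ->]|[u ->]] := iP x;
    have [[Dy ->]|[v ->]] := iP y => /fI[] //; auto.
  - by move=> /sI.
  - by move=> /sI.
  - by move=> _ /val_inj/gI[].
exists (fun p => f (i p.1) (i p.2)) => -[x y] [x' y'] /= /fI[] //.
by move=> /iI-> /iI->.
Qed.
End Square.

(** * Linear orders, sums and convex embeddings *)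

Section OrderBasics.
Variables (T : Type) (L : linear_order T).

Lemma lo_ltxx x : ~ lo_lt L x x.
Proof. by case. Qed.

Lemma lo_leNlt x y : ~ lo_lt L y x -> L x y.
Proof.
move=> h; have /orP[//|yx] := lo_total L x y.
have [->|ne] := pselect (y = x); first exact: lo_refl.
by case: h; split.
Qed.

Lemma lo_ltNle x y : lo_lt L x y -> ~ L y x.
Proof.
by move=> [xy ne] yx; apply: ne; apply: (lo_antisym (l := L)); rewrite xy.
Qed.

Lemma lo_lt_trichotomy x y : [\/ lo_lt L x y, x = y | lo_lt L y x].
Proof.
have [->|ne] := pselect (x = y); first by constructor 2.
have /orP[xy|yx] := lo_total L x y; first by constructor 1.
by constructor 3; split=> // /esym.
Qed.

Lemma lo_lt_le_trans x y z : lo_lt L x y -> L y z -> lo_lt L x z.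
Proof.
move=> [xy ne] yz; split; first exact: lo_trans yz.
by move=> e; apply: ne; apply: (lo_antisym (l := L)); rewrite xy e.
Qed.

Lemma lo_lt_trans x y z : lo_lt L x y -> lo_lt L y z -> lo_lt L x z.
Proof. by move=> xy [yz _]; exact: lo_lt_le_trans yz. Qed.

End OrderBasics.

Lemma linear_order_inj (T : Type) : injective (@lo_le T).
Proof.
move=> [l r a t o] [l' r' a' t' o'] /= e; subst l'.
by congr LinearOrder; exact: Prop_irrelevance.
Qed.

Lemma lo_embedding_lt S T (L : linear_order S) (M : linear_order T) f x y :
  lo_embedding L M f -> lo_lt M (f x) (f y) <-> lo_lt L x y.
Proof.
move=> fE; split=> -[xy ne]; split; rewrite ?fE // -?fE //.
  by move=> e; apply: ne; rewrite e.
by move=> e; apply: ne; apply: (lo_antisym (l := L)); rewrite -!fE e lo_refl.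
Qed.

Lemma lo_embedding_inj S T (L : linear_order S) (M : linear_order T) f :
  lo_embedding L M f -> injective f.
Proof.
by move=> fE x y e; apply: (lo_antisym (l := L)); rewrite -!fE e lo_refl.
Qed.

Lemma lo_lt_embedding S T (L : linear_order S) (M : linear_order T) f :
  (forall x y, lo_lt L x y -> lo_lt M (f x) (f y)) -> lo_embedding L M f.
Proof.
move=> fS x y; apply/idP/idP => xy.
  by apply: lo_leNlt => /fS yx; exact: (lo_ltNle yx xy).
have [/fS[//]|->|yx] := lo_lt_trichotomy L x y; first exact: lo_refl.
by case: (lo_ltNle yx xy).
Qed.

Section Pull.
Variables (S T : Type) (f : S -> T) (fI : injective f) (L : linear_order T).

(** The order induced on [S] by an injection into a linear order. *)
Definition lo_pull : linear_order S.
Proof.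
refine (@LinearOrder S (fun x y => L (f x) (f y)) _ _ _ _).
- by move=> x; exact: lo_refl.
- by move=> x y xy; apply: fI; exact: (lo_antisym (l := L)).
- by move=> y x z; exact: lo_trans.
- by move=> x y; exact: lo_total.
Defined.

End Pull.

Section Sum.
Variables (I T : Type) (J : linear_order I) (L : I -> linear_order T).

Let sum_le (p q : I * T) : bool :=
  `[< lo_lt J p.1 q.1 \/ p.1 = q.1 /\ L p.1 p.2 q.2 >].

(** The sum of the orders [L i] along [J], that is, the lexicographic order on
    the pairs; all summands have the same domain [T]. *)
Definition lo_sum : linear_order (I * T).
Proof.
refine (@LinearOrder _ sum_le _ _ _ _).
- by move=> [i x]; apply/asboolP; right; split=> //; exact: lo_refl.
- move=> [i x] [j y] /andP[/asboolP/= ij /asboolP/= ji].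
  case: ij ji => [ij|[<- xy]] [|].
  + by move=> ji; exfalso; apply: (lo_ltxx (lo_lt_trans ij ji)).
  + by move=> [ji]; exfalso; move: ij; rewrite ji; exact: lo_ltxx.
  + by move=> ji; case: (lo_ltxx ji).
  + by move=> [_ yx]; rewrite (@lo_antisym _ (L i) x y) // xy.
- move=> [j y] [i x] [k z] /asboolP/= ij /asboolP/= jk; apply/asboolP => /=.
  case: ij jk => [ij|[<- xy]] [jk|[jk yz]].
  + by left; exact: lo_lt_trans jk.
  + by left; rewrite -jk.
  + by left.
  + by right; split=> //; exact: lo_trans yz.
- move=> [i x] [j y]; apply/orP.
  have [ij|<-|ji] := lo_lt_trichotomy J i j.
  + by left; apply/asboolP; left.
  + have /orP[xy|yx] := lo_total (L i) x y.
      by left; apply/asboolP; right.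
    by right; apply/asboolP; right.
  + by right; apply/asboolP; left.
Defined.

Lemma lo_sum_lt i x j y :
  lo_lt lo_sum (i, x) (j, y) <-> lo_lt J i j \/ i = j /\ lo_lt (L i) x y.
Proof.
split.
  move=> [/asboolP/= [ij|[<- xy]] ne]; first by left.
  by right; split=> //; split=> // e; apply: ne; rewrite e.
move=> [ij|[<- [xy ne]]]; split.
- by apply/asboolP; left.
- by case=> e _; move: ij; rewrite e; exact: lo_ltxx.
- by apply/asboolP; right.
- by case.
Qed.

Lemma lo_sum_le_fst i x j y : lo_sum (i, x) (j, y) -> J i j.
Proof. by move=> /asboolP/= [[]//|[-> _]]; exact: lo_refl. Qed.

End Sum.

(** Embeddings onto a convex suborder. *)
Definition convex_embedding S T (L : linear_order S) (M : linear_order T)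
    (f : S -> T) :=
  lo_embedding L M f /\ lo_convex M (range f).

Lemma convex_embedding_between S T (L : linear_order S) (M : linear_order T)
    f x y z : convex_embedding L M f -> M (f x) z -> M z (f y) ->
  exists w, z = f w.
Proof.
move=> [_ fC] xz zy; have [|| w _ <-] := fC _ _ _ xz zy; first by exists x.
  by exists y.
by exists w.
Qed.

Lemma convex_embedding_comp S T U (L : linear_order S) (M : linear_order T)
    (N : linear_order U) f g : convex_embedding L M f ->
  convex_embedding M N g -> convex_embedding L N (g \o f).
Proof.
move=> fE gE; split=> [x y|a v b av vb [x _ xE] [y _ yE]] /=.
  by rewrite gE.1 fE.1.
move: av vb; rewrite -xE -yE => xv vy.
have [w vE] := convex_embedding_between gE xv vy.
move: xv vy; rewrite vE /= !gE.1 => xw wy.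
by have [u ->] := convex_embedding_between fE xw wy; exists u.
Qed.

Lemma convex_embedding_id T (L : linear_order T) : convex_embedding L L id.
Proof. by split=> // x y z _ _ _ _; exists y. Qed.

Lemma convex_embedding_sum I T (J : linear_order I) (L : I -> linear_order T)
    i : convex_embedding (L i) (lo_sum J L) (pair i).
Proof.
split=> [x y|a [j y] b aj jb [x _ xE] [z _ zE]].
  by apply/asboolP/idP => [[[]//|[]//]|xy]; right.
exists y => //; congr pair; apply: (@lo_antisym _ J).
move: aj jb; rewrite -xE -zE => ij ji.
by rewrite (lo_sum_le_fst ij) (lo_sum_le_fst ji).
Qed.

(** If [S] and [T] inject into each other, then every order on [T] is isomorphic
    to an order on [S]; the isomorphism is stated as a convex embedding. *)
Lemma linear_order_transfer S T (L : linear_order T) :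
  (exists f : S -> T, injective f) -> (exists f : T -> S, injective f) ->
  exists (M : linear_order S) (g : T -> S), convex_embedding L M g.
Proof.
move=> [f fI] [g gI].
have le1 : [set: S] #<= [set: T] by exact: (injective_card_le fI).
have le2 : [set: T] #<= [set: S] by exact: (injective_card_le gI).
have /card_bijP[h [k hK kK]] := Cantor_Bernstein le1 le2.
pose h' x := val (h (SigSub (mem_setT x))).
pose k' y := val (k (SigSub (mem_setT y))).
have hI : injective h' by move=> x y /val_inj/(can_inj hK)[].
have kK' : cancel k' h'.
  move=> y; rewrite /h' /k'; set s := SigSub _.
  have -> : s = k (SigSub (mem_setT y)) by exact: val_inj.
  by rewrite kK.
exists (lo_pull hI L), k'; split.
  by move=> x y; rewrite /lo_pull /= !kK'.
by move=> _ y _ _ _ _ _; exists (h' y) => //; apply: hI; rewrite kK'.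
Qed.

(** [y] is the immediate successor of [x]. *)
Definition lo_cover (T : Type) (L : linear_order T) x y :=
  lo_lt L x y /\ forall z, lo_lt L x z -> ~ lo_lt L z y.

Lemma convex_embedding_cover S T (L : linear_order S) (M : linear_order T) f
    x y : convex_embedding L M f ->
  lo_cover M (f x) (f y) <-> lo_cover L x y.
Proof.
move=> fE; have lt u v := lo_embedding_lt u v fE.1; split=> -[/lt xy h].
  split=> // z xz zy; apply: (h (f z)); exact/lt.
split=> // z xz zy; have [w zE] := convex_embedding_between fE xz.1 zy.1.
by move: xz zy; rewrite zE => /lt xz /lt; exact: h.
Qed.

(** * Orders coding the subsets of a set *)

(** The order 0 < ... < 5 < 3 < 1 < 2 < 4 < ... on the natural numbers: a least
    point followed by a copy of the integers. *)
Definition zigzag_le (m n : nat) : bool :=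
  (m == 0) || (n != 0) &&
  (odd m && (~~ odd n || (n <= m)) || ~~ odd m && ~~ odd n && (m <= n))%N.

(** The two kinds of blocks: both have least point 0 and no greatest point, all
    other points have an immediate predecessor, and 0 has an immediate successor
    exactly when the bit is true. *)
Definition block (b : bool) : linear_order nat.
Proof.
refine (if b then @LinearOrder nat leq _ _ _ _
  else @LinearOrder nat zigzag_le _ _ _ _).
- exact: leqnn.
- exact: anti_leq.
- exact: leq_trans.
- exact: leq_total.
- by rewrite /zigzag_le => m; lia.
- by rewrite /zigzag_le => m n; lia.
- by rewrite /zigzag_le => m n p; lia.
- by rewrite /zigzag_le => m n; lia.
Defined.

Lemma block_lt_true m n : lo_lt (block true) m n <-> (m < n)%N.
Proof. by rewrite /lo_lt /=; lia. Qed.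

Lemma block_lt_false m n :
  lo_lt (block false) m n <-> zigzag_le m n && (m != n).
Proof. by rewrite /lo_lt /=; split=> [[-> /eqP]//|/andP[-> /eqP]]. Qed.

Lemma block_least b n : block b 0 n.
Proof. by case: b. Qed.

Lemma block_unbounded b n : exists m, lo_lt (block b) n m.
Proof.
case: b; first by exists n.+1; apply/block_lt_true.
have [on|en] := boolP (odd n).
  by exists 2; apply/block_lt_false; rewrite /zigzag_le; lia.
by exists n.+2; apply/block_lt_false; rewrite /zigzag_le; lia.
Qed.

Lemma block_predecessor b n : n <> 0 -> exists m, lo_cover (block b) m n.
Proof.
case: b => n0.
  by exists n.-1; split=> [|z]; rewrite !block_lt_true; lia.
have [on|en] := boolP (odd n).
  by exists n.+2; split=> [|z]; rewrite !block_lt_false /zigzag_le; lia.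
have [->|n2] := eqVneq n 2.
  by exists 1; split=> [|z]; rewrite !block_lt_false /zigzag_le; lia.
by exists n.-2; split=> [|z]; rewrite !block_lt_false /zigzag_le; lia.
Qed.

Lemma block_cover0 b : (exists n, lo_cover (block b) 0 n) <-> b.
Proof.
split=> [[n [n0]]|->]; last first.
  by exists 1; split=> [|z]; rewrite !block_lt_true; lia.
case: b n0 => // /block_lt_false n0.
move=> /(_ (if odd n then n.+2 else 1)); rewrite !block_lt_false.
by move: n0; rewrite /zigzag_le; case: ifP; lia.
Qed.

Lemma exists_well_order (K : Type) : exists W : linear_order K,
  forall A : set K, A !=set0 -> exists2 x, A x & forall y, A y -> W x y.
Proof.
elim/Peq: K => K; have [R Rwo] := well_ordering_principle K.
have RwoT : wo_chain R predT by move=> A _; exact: Rwo.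
have Rmin (A : set K) : A !=set0 -> exists2 x, A x & forall y, A y -> R x y.
  move=> [a Aa]; have [|x [[xA xmin] _]] := Rwo (mem A).
    by exists a; rewrite inE.
  exists x; first by move: xA; rewrite inE.
  by move=> y Ay; apply: xmin; rewrite inE.
have Rxx : reflexive R by move=> x; exact: (wo_chain_reflexive RwoT).
have Ranti : antisymmetric R.
  by move=> x y; exact: (wo_chain_antisymmetric RwoT).
have Rtot : total R by move=> x y; exact: (wo_chainW RwoT).
have Rtr : transitive R.
  move=> y x z xy yz.
  have [|w Aw wmin] := Rmin [set x; y; z]; first by exists x; do 2 left.
  have wx : R w x by apply: wmin; do 2 left.
  have wy : R w y by apply: wmin; left; right.
  have wz : R w z by apply: wmin; right.
  case: Aw => [[]|] /= wE; first by rewrite -wE.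
    by have -> : x = y by apply: Ranti; rewrite xy -wE.
  have <- : y = z by apply: Ranti; rewrite yz -wE.
  exact: xy.
by exists (LinearOrder Rxx Ranti Rtr Rtot).
Qed.

Section CodedOrders.
Variables (K : Type) (W : linear_order K) (k0 : K).
Hypothesis W_wf :
  forall A : set K, A !=set0 -> exists2 x, A x & forall y, A y -> W x y.
Hypothesis k0_least : forall k, W k0 k.

(** The order A_X: the sum along [W] of the blocks given by the bits of [X]. *)
Definition coded_order (X : K -> bool) : linear_order (K * nat) :=
  lo_sum W (fun k => block (X k)).

Lemma coded_order_least X p : coded_order X (k0, 0) p.
Proof.
case: p => k n; apply/asboolP => /=.
have [<-|ne] := pselect (k0 = k); last by left.
by right; split=> //; exact: block_least.
Qed.

Lemma coded_order_cover_same X k m n :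
  lo_cover (block (X k)) m n -> lo_cover (coded_order X) (k, m) (k, n).
Proof.
move=> [mn h]; split; first by apply/lo_sum_lt; right.
move=> [j p] /lo_sum_lt mp /lo_sum_lt pn.
case: mp pn => [kj|[<- mp]] [jk|[jk pn]].
- by apply: (lo_ltxx (lo_lt_trans kj jk)).
- by move: kj; rewrite jk; exact: lo_ltxx.
- by move: jk; exact: lo_ltxx.
- exact: (h p).
Qed.

Lemma coded_order_no_pred X k p : ~ lo_cover (coded_order X) p (k, 0).
Proof.
case: p => j n [/lo_sum_lt [jk|[-> n0]]] h.
  have [m nm] := block_unbounded (X j) n.
  by apply: (h (j, m)); apply/lo_sum_lt; [right|left].
exact: (lo_ltNle n0 (block_least _ _)).
Qed.

Lemma coded_order_succ X k :
  (exists p, lo_cover (coded_order X) (k, 0) p) <-> X k.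
Proof.
split=> [[[j n] [/lo_sum_lt kj h]]|/block_cover0[n cn]]; last first.
  by exists (k, n); exact: coded_order_cover_same.
apply/block_cover0; case: kj => [kj|[kj n0]].
  have [m m0] := block_unbounded (X k) 0.
  by exfalso; apply: (h (k, m)); apply/lo_sum_lt; [right|left].
exists n; split=> // m m0 mn; rewrite -kj in h.
by apply: (h (k, m)); apply/lo_sum_lt; right.
Qed.

Variables (T : Type) (M : linear_order T).

Section TwoEmbeddings.
Variables (X Y : K -> bool) (f g : K * nat -> T).
Hypotheses (fE : convex_embedding (coded_order X) M f)
           (gE : convex_embedding (coded_order Y) M g)
           (fg0 : f (k0, 0) = g (k0, 0)).

(** The inductive step for [coded_order_determined].  If [f (k, 0)] were below
    [g (k, 0)], it would be the image under [g] of a point of an earlier block.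
    That point is not the first of its block, since [f] and [g] agree on the
    earlier first points; so it has an immediate predecessor, and by convexity
    so does [(k, 0)] in the order of [X], which is impossible. *)
Lemma coded_heads_not_lt k :
  (forall j, lo_lt W j k -> f (j, 0) = g (j, 0)) ->
  ~ lo_lt M (f (k, 0)) (g (k, 0)).
Proof.
move=> IH fg.
have gf0 : M (g (k0, 0)) (f (k, 0)).
  by rewrite -fg0 fE.1; exact: coded_order_least.
have [[j n] E] := convex_embedding_between gE gf0 fg.1.
move: fg; rewrite E (lo_embedding_lt _ _ gE.1) => /lo_sum_lt.
move=> [jk|[_ n0]]; last first.
  exact: (lo_ltNle n0 (block_least _ _)).
have fgj := IH _ jk.
have [n0|n0] := pselect (n = 0).
  move: E; rewrite n0 -fgj => /(lo_embedding_inj fE.1)[kj].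
  by move: jk; rewrite kj; exact: lo_ltxx.
have [m mn] := block_predecessor (Y j) n0.
have /(convex_embedding_cover _ _ gE) := coded_order_cover_same mn.
rewrite -E => cov.
have fm : M (f (j, 0)) (g (j, m)).
  rewrite fgj gE.1; apply/asboolP; right; split=> //; exact: block_least.
have [z zE] := convex_embedding_between fE fm cov.1.1.
move: cov; rewrite zE (convex_embedding_cover _ _ fE).
exact: coded_order_no_pred.
Qed.

Lemma coded_bit_le k : f (k, 0) = g (k, 0) -> X k -> Y k.
Proof.
move=> fgk /coded_order_succ[p /(convex_embedding_cover _ _ fE) cov].
rewrite fgk in cov; apply/coded_order_succ.
have [m m0] := block_unbounded (Y k) 0.
have lt0m : lo_lt (coded_order Y) (k, 0) (k, m) by apply/lo_sum_lt; right.
have le : M (f p) (g (k, m)).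
  by apply: lo_leNlt; apply: cov.2; rewrite (lo_embedding_lt _ _ gE.1).
have [z zE] := convex_embedding_between gE cov.1.1 le.
by exists z; apply/(convex_embedding_cover _ _ gE); rewrite -zE.
Qed.
End TwoEmbeddings.

(** An order A_X with an embedding onto a convex suborder of [M] is determined
    by the image of its least point. *)
Theorem coded_order_determined X Y f g :
  convex_embedding (coded_order X) M f ->
  convex_embedding (coded_order Y) M g ->
  f (k0, 0) = g (k0, 0) -> X = Y.
Proof.
move=> fE gE fg0.
have heads k : f (k, 0) = g (k, 0).
  apply: contrapT => nk.
  have [k1 nk1 k1min] :=
    W_wf (A := [set k | f (k, 0) <> g (k, 0)]) (ex_intro _ k nk).
  have IH j : lo_lt W j k1 -> f (j, 0) = g (j, 0).
    by move=> jk; apply: contrapT => /k1min; exact: lo_ltNle.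
  have [lt|//|lt] := lo_lt_trichotomy M (f (k1, 0)) (g (k1, 0)).
    exact: (coded_heads_not_lt fE gE fg0 IH lt).
  by apply: (coded_heads_not_lt gE fE (esym fg0) _ lt) => j /IH.
apply: funext => k; apply/idP/idP.
  exact: (coded_bit_le fE gE (heads k)).
exact: (coded_bit_le gE fE (esym (heads k))).
Qed.

End CodedOrders.

(** * Copies inside a single piece *)

(** A convex partition with index [J] of an order containing [N]-many copies of
    [A] has a piece that contains a whole copy, unless [N] embeds in [J]. *)
Lemma convex_partition_copy (I T S V : Type) (N : linear_order I)
    (A : linear_order T) (L : linear_order S) (J : linear_order V)
    (P : V -> set S) (e : I * T -> S) :
  convex_partition J L P -> lo_embedding (lo_sum N (fun=> A)) L e ->
  inhabited T ->
  lo_embeds N J \/ exists i k, forall t, P k (e (i, t)).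
Proof.
move=> [[Pcover Ptriv _] Plt] eE [t0].
have Pex x : exists k, P k x.
  have [k _ Pk] : cover setT P x by rewrite Pcover.
  by exists k.
apply: contrapT => /not_orP[nNJ ncopy].
(* Each copy meets two pieces: p i is one that is not the first. *)
have /choice[p pP] : forall i, exists k,
    (exists t, P k (e (i, t))) /\
    exists k' t', lo_lt J k' k /\ P k' (e (i, t')).
  move=> i; have [k Pk] := Pex (e (i, t0)).
  have [t nt] : exists t, ~ P k (e (i, t)).
    by apply/existsNP => h; apply: ncopy; exists i, k.
  have [k' Pk'] := Pex (e (i, t)).
  have [kk'|kk'|k'k] := lo_lt_trichotomy J k k'.
  - by exists k'; split; [exists t|exists k, t0].
  - by case: nt; rewrite kk'.
  - by exists k; split; [exists t0|exists k', t].
apply: nNJ; exists p; apply: lo_lt_embedding => i i' ii'.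
have [[t Pt] _] := pP i; have [_ [k [t' [kp Pk]]]] := pP i'.
have lt_e : lo_lt L (e (i, t)) (e (i', t')).
  by apply/(lo_embedding_lt _ _ eE)/lo_sum_lt; left.
have [//|pp|pp] := lo_lt_trichotomy J (p i) (p i'); exfalso.
  apply: (lo_ltxx (lo_lt_trans lt_e ((Plt k (p i')).1 kp _ _ Pk _))).
  by rewrite -pp.
have kpi := lo_lt_trans kp pp.
exact: (lo_ltxx (lo_lt_trans lt_e ((Plt k (p i)).1 kpi _ _ Pk Pt))).
Qed.

(** If [N] lies outside the class, then an order piecewise above [N]-many copies
    of [A] has a convex suborder isomorphic to [A]. *)
Lemma piecewise_convex_copy (K : Type) (LL : set (lin K)) (N : lin K)
    (T S U : Type) (A : linear_order T) (L : linear_order S)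
    (M : linear_order U) (e : lin_dom N * T -> S) :
  downward_closed LL -> ~ LL N -> inhabited T ->
  convex_embedding (lo_sum N (fun=> A)) L e -> piecewise_convex_le LL L M ->
  exists f, convex_embedding A M f.
Proof.
move=> LLd nN iT eE [J [LLJ [P [PJ [f [fE fP]]]]]].
have [NJ|[i [k Pk]]] := convex_partition_copy PJ eE.1 iT.
  by case: nN; exact: LLd LLJ.
have eiE : convex_embedding A L (e \o pair i).
  exact: convex_embedding_comp (convex_embedding_sum _ (fun=> A) i) eE.
exists (f \o (e \o pair i)); split=> [x y|a v b av vb [x _ xE] [y _ yE]].
  by rewrite /= fE eiE.1.
have [s _ sE] : (f @` P k) v.
  by apply: (fP k a v b av vb); rewrite -?xE -?yE /=; eexists.
move: av vb; rewrite -xE -yE -sE /= !fE => xs sy.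
by have [w ->] := convex_embedding_between eiE xs sy; exists w.
Qed.

(** A convex embedding is piecewise convex for the partition with one piece; by
    downward closure, a nonempty class contains the one-point orders. *)
Lemma convex_embedding_piecewise (K : Type) (LL : set (lin K)) (S T : Type)
    (L : linear_order S) (M : linear_order T) f :
  downward_closed LL -> LL !=set0 -> inhabited S ->
  convex_embedding L M f -> piecewise_convex_le LL L M.
Proof.
move=> LLd [J LLJ] [s0] fE; have [x Jx] := lin_dom_neq0 J.
have set1_eq (i j : [set x]) : i = j.
  apply: val_inj; transitivity x; first exact: (set_mem (valP i)).
  by rewrite (set_mem (valP j) : val j = x).
have cI : injective (fun _ : [set x] => SigSub (mem_set Jx) : lin_dom J).
  by move=> i j _; exact: set1_eq.
have x1 : [set x] !=set0 by exists x.
exists (Lin x1 (lo_pull cI J)); split; first by apply: LLd LLJ; eexists.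
exists (fun=> setT); split; last first.
  by exists f; split; [exact: fE.1|move=> _; exact: fE.2].
split; first split.
- apply/seteqP; split=> // s _.
  by exists (SigSub (mem_set erefl : x \in [set x])).
- by move=> i j _ _ _; exact: set1_eq.
- by move=> i _; exists s0.
move=> k k'; split=> [[_ kk']|lt]; first by case: kk'; exact: set1_eq.
by case: (@lo_ltxx _ L s0); exact: lt.
Qed.

(** * Counting *)

Section Counting.
Variables (K : Type) (c : K * K -> K).
Hypothesis cI : injective c.

(** If the power set of [K] injects into [U * K], then it injects into [U].
    View subsets of [K] as subsets [X] of [K * K].  If for some [k] every subset
    of [K] is the [k]-th section of some [X] with [(H X).2 = k], then [H]
    restricted to such [X] has constant second component.  Otherwise choose for
    each [k] a subset [s k] that is no such section: the [X] with sections [s k]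
    has no possible value of [(H X).2]. *)
Lemma power_injection_factor (U : Type) (H : (K -> bool) -> U * K) :
  injective H -> exists g : (K -> bool) -> U,
    injective g /\ forall s, exists X, g s = (H X).1.
Proof.
move=> HI.
pose coded (X : K * K -> bool) z := `[< exists p, c p = z /\ X p >].
have codedE X p : coded X (c p) = X p.
  apply/asboolP/idP => [[q [/cI-> //]]|Xp]; by exists p.
have codedI X Y : coded X = coded Y -> X = Y.
  by move=> e; apply: funext => p; rewrite -!codedE e.
have [[k /choice[h hP]]|nk] := pselect (exists k, forall s : K -> bool,
    exists X, (forall j, X (k, j) = s j) /\ (H (coded X)).2 = k).
  exists (fun s => (H (coded (h s))).1); split; last by move=> s; eexists.
  move=> s t e; have [hs ks] := hP s; have [ht kt] := hP t.
  have /HI/codedI hst : H (coded (h s)) = H (coded (h t)).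
    by rewrite [LHS]surjective_pairing [RHS]surjective_pairing e ks kt.
  by apply: funext => j; rewrite -hs -ht hst.
have /choice[s sP] : forall k, exists s : K -> bool, forall X,
    (forall j, X (k, j) = s j) -> (H (coded X)).2 <> k.
  move=> k; have /existsNP[s ns] : ~ forall s : K -> bool,
      exists X : K * K -> bool,
        (forall j, X (k, j) = s j) /\ (H (coded X)).2 = k.
    by move=> h; apply: nk; exists k.
  by exists s => X Xs Hk; apply: ns; exists X.
by case: (sP _ (fun p => s p.1 p.2) _ erefl).
Qed.

Lemma no_power_injection (H : (K -> bool) -> K) : ~ injective H.
Proof.
move=> HI; pose X k := `[< exists2 Y, H Y = k & ~~ Y k >].
have [XH|nXH] := boolP (X (H X)).
  by have /asboolP[Y /HI-> /negP] := XH.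
by case/asboolP: (nXH); exists X.
Qed.

Lemma linear_orders_card_le (F : set (linear_order K)) :
  F #<= [set: K -> bool].
Proof.
apply: card_le_trans (card_leT F) _.
pose code (L : linear_order K) z := `[< exists x y, c (x, y) = z /\ L x y >].
apply/pcard_injP; exists code => L M _ _ e; apply: linear_order_inj.
have codeE (L' : linear_order K) x y : code L' (c (x, y)) = L' x y.
  by apply/asboolP/idP => [[u [v [/cI[-> ->]]]]|xy] //; exists x, y.
by apply: funext => x; apply: funext => y; rewrite -!codeE e.
Qed.

End Counting.

(** * Extensions containing coded orders *)

Section Extensions.
Variables (K : Type) (LL : set (lin K)).
Hypotheses (K_infinite : infinite_set [set: K]) (LL_nonempty : LL !=set0)
  (LL_downward : downward_closed LL).
Variable N : lin K.
Hypothesis LL_N : ~ LL N.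
Variables (W : linear_order K) (k0 : K).

(** Up to isomorphism, [M] is [L] followed by [N]-many copies of A_X. *)
Lemma coded_extension (L : linear_order K) X : exists M : linear_order K,
  piecewise_convex_le LL L M /\
  forall M' : linear_order K, piecewise_convex_le LL M M' ->
    exists f, convex_embedding (coded_order W X) M' f.
Proof.
have [c cI] := infinite_square K_infinite.
have [s [sI _]] := infinite_set_nat_injection K_infinite.
have [a0 Na0] := lin_dom_neq0 N.
have [||NA [g gE]] := linear_order_transfer (S := K)
    (lo_sum N (fun=> coded_order W X)).
- by exists (fun k => (SigSub (mem_set Na0), (k, 0))) => x y [].
- exists (fun p => c (val p.1, c (p.2.1, s p.2.2))) => -[a [k n]] [b [l m]].
  by move=> /cI[/val_inj -> /cI[-> /sI ->]].
have bI : injective nat_of_bool by case; case.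
have [||M [h hE]] := linear_order_transfer (S := K)
    (lo_sum (lo_pull bI (block true)) (fun b => if b then NA else L)).
- by exists (pair true) => x y [].
- exists (fun p : bool * K => c (s p.1, p.2)) => -[a x] [b y].
  by move=> /cI[/sI/bI -> ->].
have hbE b := convex_embedding_comp (convex_embedding_sum _ _ b) hE.
exists M; split.
  apply: convex_embedding_piecewise (hbE false) => //; exact: inhabits k0.
have NAE := convex_embedding_comp gE (hbE true).
move=> M'; apply: piecewise_convex_copy NAE => //.
exact: inhabits (k0, 0).
Qed.

Hypothesis W_wf :
  forall A : set K, A !=set0 -> exists2 x, A x & forall y, A y -> W x y.
Hypothesis k0_least : forall k, W k0 k.

Lemma exists_coded_not_embedded (L : linear_order K) :
  exists X, ~ exists f, convex_embedding (coded_order W X) L f.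
Proof.
apply/existsNP => /choice[f fE].
apply: (@no_power_injection K (fun X => f X (k0, 0))) => X Y.
exact: (coded_order_determined W_wf k0_least (fE X) (fE Y)).
Qed.

Lemma no_maximal_elt : ~ exists L, maximal_elt (piecewise_convex_le_on LL) L.
Proof.
move=> [L]; apply; have [X nX] := exists_coded_not_embedded L.
by have [M [LM MX]] := coded_extension L X; exists M; split=> // /MX.
Qed.

Lemma dominating_card (F : set (linear_order K)) :
  dominating (piecewise_convex_le_on LL) F -> F #= [set: K -> bool].
Proof.
move=> Fdom; have [c cI] := infinite_square K_infinite.
apply: Cantor_Bernstein; first exact: linear_orders_card_le cI F.
have /choice[h hP] : forall X, exists h : linear_order K * K, F h.1 /\
    exists2 f, convex_embedding (coded_order W X) h.1 f & f (k0, 0) = h.2.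
  move=> X; have [M [_ MX]] := coded_extension W X.
  have [y Fy /MX[f fE]] := Fdom M.
  by exists (y, f (k0, 0)); split=> //; exists f.
have hI : injective h.
  move=> X Y e; have [_ [f fE f0]] := hP X; have [_ [g gE g0]] := hP Y.
  rewrite -e in gE g0.
  by apply: (coded_order_determined W_wf k0_least fE gE); rewrite f0 g0.
have [g [gI gP]] := power_injection_factor cI hI.
have Fg s : F (g s) by have [X ->] := gP s; have [] := hP X.
exact: injective_card_le Fg.
Qed.

End Extensions.

Theorem theorem8p8 (K : Type) (LL : set (lin K))
    (K_infinite : infinite_set [set: K])
    (LL_proper : LL `<` [set: lin K])
    (LL_nonempty : LL !=set0)
    (LL_downward : downward_closed LL)
    (LL_trans : Transitive (piecewise_convex_le_on LL)) :
  [/\ ~ (exists L : linear_order K, maximal_elt (piecewise_convex_le_on LL) L),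
      forall F : set (linear_order K),
        dominating (piecewise_convex_le_on LL) F -> F #= [set: K -> bool]
    & dominating_number_is (piecewise_convex_le_on LL) [set: K -> bool]].
Proof.
have [_ /existsNP[N /not_implyP[_ nN]]] := LL_proper.
have [W W_wf] := exists_well_order K.
have [k0 _ k0_le] := W_wf setT (infinite_setN0 K_infinite).
have k0_least k : W k0 k by exact: k0_le.
have card F := @dominating_card _ _ K_infinite LL_nonempty LL_downward _ nN
  _ _ W_wf k0_least F.
split=> //.
  exact: (no_maximal_elt K_infinite LL_nonempty LL_downward nN W_wf k0_least).
split=> [|F /card]; last by rewrite card_eq_le => /andP[].
exists setT; last apply: card.
  all: move=> L; exists L => //.
  all: have k0i := inhabits k0.
  all: apply: (convex_embedding_piecewise LL_downward LL_nonempty k0i).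
  all: exact: convex_embedding_id.
Qed.
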